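(* Let $\Gamma=\Gamma_d(a_1,b_1,c_1,\ldots,a_t,b_t,c_t;m_1,\ldots,m_t)$ have order $n$, where $d$, $t$ and the $a_i,b_i,c_i$ are fixed and $n=(d+1)(m_1+\cdots+m_t)\to\infty$, and let $\ell=\min\{a_jb_jc_j: j=1,\ldots,t\}$. Then $\mu(\Gamma)\ge(1+o(1))\frac{\ell\pi^2}{n^2}$.
   Context: $\mu$ is the second smallest eigenvalue of the Laplacian (degree matrix minus adjacency matrix). The sequential join $G_1+\cdots+G_k$ joins every vertex of $G_i$ to every vertex of $G_{i+1}$. $\mathcal{G}(a,b,c;m)$ is the sequential join of $3m$ cliques $K_a,K_b,K_c,\ldots,K_a,K_b,K_c$ (its cells). For $d\ge2$, $t\ge1$ and positive integers with $a_i+b_i+c_i=d+1$, $\Gamma_d(a_1,b_1,c_1,\ldots,a_t,b_t,c_t;m_1,\ldots,m_t)$ is obtained from the disjoint union of $\mathcal{G}_i=\mathcal{G}(a_i,b_i,c_i;m_i)$, $i=1,\ldots,t$, by joining every vertex of the last cell of $\mathcal{G}_i$ to every vertex of the first cell of $\mathcal{G}_{i+1}$ for $i=1,\ldots,t-1$. *)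

(* Defs.v *)
From HB Require Import structures.
From mathcomp Require Import all_boot all_order all_algebra.
From mathcomp Require Import all_classical all_reals all_analysis.
Set Implicit Arguments.
Unset Strict Implicit.
Unset Printing Implicit Defensive.

Import Order.TTheory GRing.Theory Num.Theory.
Import numFieldNormedType.Exports.
Local Open Scope ring_scope.

Record sgraph := SGraph {
  vertex :> finType;
  adj : rel vertex;
  adj_sym : symmetric adj;
  adj_irrefl : irreflexive adj }.

Lemma clique_sym (T : finType) : symmetric (fun x y : T => x != y).
Proof. by move=> x y; rewrite eq_sym. Qed.

Lemma clique_irrefl (T : finType) : irreflexive (fun x y : T => x != y).
Proof. by move=> x; rewrite eqxx. Qed.

Definition clique (n : nat) : sgraph :=
  SGraph (@clique_sym 'I_n) (@clique_irrefl 'I_n).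

(* The disjoint union of the graphs [G i], together with the edges between    *)
(* vertices of different components that are prescribed, in one direction, by *)
(* [link]; each of them is made undirected.                                   *)
Definition linked_adj (k : nat) (G : 'I_k -> sgraph)
    (link : rel {i : 'I_k & G i}) : rel {i : 'I_k & G i} := fun u v =>
  if tag u == tag v then adj (tagged u) (tagged_as u v)
  else link u v || link v u.

Lemma linked_adj_sym (k : nat) (G : 'I_k -> sgraph)
  (link : rel {i : 'I_k & G i}) : symmetric (linked_adj link).
Proof.
case=> i x [j y]; rewrite /linked_adj /=.
case: (eqVneq i j) => [eq_ij|_]; last by rewrite orbC.
case: _ / eq_ij y => y.
rewrite -![existT _ i _]/(Tagged (fun i => vertex (G i)) _).
by rewrite !tagged_asE adj_sym.
Qed.

Lemma linked_adj_irrefl (k : nat) (G : 'I_k -> sgraph)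
  (link : rel {i : 'I_k & G i}) : irreflexive (linked_adj link).
Proof.
case=> i x; rewrite /linked_adj eqxx.
by rewrite -/(Tagged (fun i => vertex (G i)) x) tagged_asE adj_irrefl.
Qed.

Definition linked_union (k : nat) (G : 'I_k -> sgraph)
    (link : rel {i : 'I_k & G i}) : sgraph :=
  SGraph (linked_adj_sym link) (linked_adj_irrefl link).

Definition seq_join (k : nat) (G : 'I_k -> sgraph) : sgraph :=
  linked_union (fun u v : {i : 'I_k & G i} => (tag u).+1 == tag v).

Definition cell_size (a b c k : nat) : nat :=
  match (k %% 3)%N with 0 => a | 1 => b | _ => c end.

Definition clique_chain (a b c m : nat) : sgraph :=
  seq_join (fun k : 'I_(3 * m) => clique (cell_size a b c k)).

Definition cell (a b c m : nat) (x : clique_chain a b c m) : 'I_(3 * m) :=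
  tag x.

Definition Gamma (t : nat) (a b c m : 'I_t -> nat) : sgraph :=
  linked_union
    (fun u v : {i : 'I_t & clique_chain (a i) (b i) (c i) (m i)} =>
       [&& (tag u).+1 == tag v,
           (cell (tagged u)).+1 == (3 * m (tag u))%N
         & cell (tagged v) == 0%N :> nat]).

Definition degree (G : sgraph) (x : G) : nat := #|[set y : G | adj x y]|.

Definition degree_mx (R : realType) (G : sgraph) : 'M[R]_#|G| :=
  diag_mx (\row_i (degree (enum_val i))%:R).

Definition adjacency_mx (R : realType) (G : sgraph) : 'M[R]_#|G| :=
  \matrix_(i, j) (adj (enum_val i) (enum_val j))%:R.

Definition laplacian (R : realType) (G : sgraph) : 'M[R]_#|G| :=
  degree_mx R G - adjacency_mx R G.

(* The eigenvalues in increasing order, repeated according to algebraic       *)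
(* multiplicity; empty if the characteristic polynomial does not split, which *)
(* never happens for a symmetric matrix.                                      *)
Definition eigenvalues (R : realType) (n : nat) (A : 'M[R]_n) : seq R :=
  xget [::] [set s : seq R | sorted <=%R s /\
                             char_poly A = \prod_(x <- s) ('X - x%:P)]%classic.

(* Counted with multiplicity: it is 0 when the graph is disconnected. *)
Definition mu (R : realType) (G : sgraph) : R :=
  nth 0 (eigenvalues (laplacian R G)) 1.

(* Main.v *)
(* Number the cells consecutively along Gamma, let s k be the size of cell k,
   and order the n vertices cell by cell. The part of a test function
   orthogonal to the cellwise constant ones has Rayleigh quotient at least 1,
   so what is needed is a Poincare inequality on a path with masses s k and
   conductances s k * s (k + 1). For y of mean zero let F j be the sum of the
   first j values: then F vanishes at 0 and n, the norm sum_k s k * y k ^ 2 is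
   the Dirichlet energy of F, and summation by parts together with Cauchy-
   Schwarz reduces the Poincare inequality to bounding the sum of F ^ 2 / (s k
   * s (k + 1)) over the ends of the cells by the energy. In a period a, b, c
   these weights add up to (d + 1) / (abc), so up to the oscillation of F over
   a period (and up to t exceptional edges between blocks) that sum is at most
   the sum of all F j ^ 2 divided by l. The latter is controlled by the
   Dirichlet eigenvalue 2 (1 - cos (pi / n)) of the path with n edges; the
   errors have relative size O(1 / n). *)

Require Import Defs.
From HB Require Import structures.
From mathcomp Require Import all_boot all_order all_algebra.
From mathcomp Require Import all_classical all_reals all_analysis.
From mathcomp Require Import ring lra zify.
From mathcomp Require Import complex perm.
Import Order.TTheory GRing.Theory Num.Theory.
Import numFieldNormedType.Exports.
Local Open Scope classical_set_scope.
Local Open Scope ring_scope.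
Set Implicit Arguments.
Unset Strict Implicit.
Unset Printing Implicit Defensive.

Local Open Scope sesquilinear_scope.

(** * Eigenvalues of real symmetric matrices *)

(** Seen over [R[i]], [A] is Hermitian, hence unitarily diagonalisable with real spectrum; the
    factorisation of [char_poly A] descends to [R] since [map_poly] along the embedding is
    injective. [P] itself may be complex. *)
Lemma symmetric_spectral (R : rcfType) (n : nat) (A : 'M[R]_n) :
    A^T = A ->
  exists (P : 'M[R[i]]_n) (d : 'I_n -> R),
    [/\ P *m P ^t* = 1%:M,
        map_mx (real_complex R) A =
          P ^t* *m diag_mx (\row_i (real_complex R (d i))) *m P
      & char_poly A = \prod_i ('X - (d i)%:P)].
Proof.
move=> Asym; pose AC := map_mx (real_complex R) A.
have AC_herm : AC \is hermsymmx.
  apply: realsym_hermsym.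
    apply/is_hermitianmxP; rewrite expr0 scale1r map_mx_id//.
    by rewrite /AC map_trmx Asym.
  by apply/mxOverP => i j; rewrite mxE complex_real.
have /hermitian_normalmx/orthomx_spectralP := AC_herm.
have Pu := spectral_unitarymx AC.
have Dreal := hermitian_spectral_diag_real AC_herm.
move: (spectralmx AC) (spectral_diag AC) Pu Dreal => P D Pu /mxOverP Dreal ACE.
exists P, (fun i => complex.Re (D 0 i)).
have DE : D = \row_i (real_complex R (complex.Re (D 0 i))).
  by apply/rowP => i; rewrite mxE RRe_real.
rewrite -DE -invmx_unitary//; split=> //.
  by rewrite mulmxV ?unitarymx_unit.
apply: (@map_poly_inj _ _ (real_complex R)).
rewrite map_char_poly -/AC rmorph_prod/=.
transitivity (char_poly (diag_mx D)).
  rewrite /char_poly /char_poly_mx ACE.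
  pose Q := map_mx polyC P; pose Qi := map_mx polyC (invmx P).
  have QiQ : Qi *m Q = 1%:M by rewrite -map_mxM mulVmx ?unitarymx_unit// map_mx1.
  have -> : 'X%:M - map_mx polyC (invmx P *m diag_mx D *m P) =
      Qi *m ('X%:M - map_mx polyC (diag_mx D)) *m Q.
    rewrite mulmxBr mulmxBl !map_mxM; congr (_ - _).
    by rewrite scalar_mxC -mulmxA QiQ mulmx1.
  by rewrite !det_mulmx mulrAC mulrC -det_mulmx QiQ det1 mulr1.
rewrite char_poly_trig; last first.
  apply/is_trig_mxP => i j ij; rewrite mxE.
  by case: eqP => // eij; move: ij; rewrite eij ltnn.
apply: eq_bigr => i _.
by rewrite mxE eqxx mulr1n map_polyXsubC {1}DE mxE.
Qed.

Lemma Re_mul_conj (R : rcfType) (z t : R[i]) :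
  complex.Re (z * Num.conj t) =
  complex.Re z * complex.Re t + complex.Im z * complex.Im t.
Proof.
by case: z t => r1 r2 [r3 r4]; rewrite -[Num.conj _]/(conjc _) /= mulrN opprK.
Qed.

Lemma Re_sum (R : rcfType) (I : finType) (F : I -> R[i]) :
  complex.Re (\sum_i F i) = \sum_i complex.Re (F i).
Proof.
by apply: (@big_morph _ _ (@complex.Re R) 0 +%R 0 +%R) => // -[? ?] [? ?].
Qed.

Lemma Im_sum (R : rcfType) (I : finType) (F : I -> R[i]) :
  complex.Im (\sum_i F i) = \sum_i complex.Im (F i).
Proof.
by apply: (@big_morph _ _ (@complex.Im R) 0 +%R 0 +%R) => // -[? ?] [? ?].
Qed.

(** A real matrix does not mix the two parts, so a bound for real vectors can be applied to the real
    and to the imaginary part of a complex one. *)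
Lemma Re_quad (R : rcfType) n (u : 'rV[R[i]]_n) (A : 'M[R]_n) :
  complex.Re ((u *m map_mx (real_complex R) A *m u ^t* ) 0 0) =
  \sum_i \sum_j (complex.Re (u 0 i) * A i j * complex.Re (u 0 j) +
                 complex.Im (u 0 i) * A i j * complex.Im (u 0 j)).
Proof.
rewrite mxE Re_sum exchange_big; apply: eq_bigr => j _ /=.
rewrite mxE mulr_suml Re_sum; apply: eq_bigr => i _; rewrite !mxE Re_mul_conj.
by case: (u 0 i) => r1 r2 /=; ring.
Qed.

Lemma Re_quad_diag (R : rcfType) n (u : 'rV[R[i]]_n) (d : 'I_n -> R) :
  complex.Re ((u *m diag_mx (\row_i (real_complex R (d i))) *m u ^t* ) 0 0) =
  \sum_i d i * (complex.Re (u 0 i) ^+ 2 + complex.Im (u 0 i) ^+ 2).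
Proof.
rewrite mul_mx_diag mxE Re_sum; apply: eq_bigr => i _; rewrite !mxE Re_mul_conj.
by case: (u 0 i) => r1 r2 /=; ring.
Qed.

Lemma Re_norm (R : rcfType) n (u : 'rV[R[i]]_n) :
  complex.Re ((u *m u ^t* ) 0 0) =
  \sum_i (complex.Re (u 0 i) ^+ 2 + complex.Im (u 0 i) ^+ 2).
Proof.
rewrite mxE Re_sum; apply: eq_bigr => i _.
by rewrite !mxE Re_mul_conj -!expr2.
Qed.

(* The two lowest eigenvectors span a plane, which meets the hyperplane of    *)
(* vectors with zero sum.                                                     *)
Lemma second_eigenvalue_ge (R : realType) (n : nat) (A : 'M[R]_n) (lam : R) :
    (1 < n)%N -> A^T = A ->
    (forall x : 'I_n -> R, \sum_i x i = 0 ->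
      lam * \sum_i x i ^+ 2 <= \sum_i \sum_j x i * A i j * x j) ->
  lam <= nth 0 (eigenvalues A) 1.
Proof.
move=> n_gt1 Asym Alam; rewrite /eigenvalues.
case: xgetP => [s _ [s_sorted sE]|noS]; last first.
  (* The default [[::]] never occurs: sorting the spectrum gives an admissible list. *)
  have [P [d [_ _ dE]]] := symmetric_spectral Asym.
  case: (noS (sort <=%R [seq d i | i <- index_enum 'I_n])).
  split; first exact: sort_le_sorted.
  rewrite (perm_big _ (permEl (perm_sort _ _))).
  by rewrite big_map.
have [P [d [PP AE dE]]] := symmetric_spectral Asym.
have ds : perm_eq s (mktuple d).
  by apply: prod_XsubC_eq; rewrite -sE dE big_map big_enum.
have size_s : size s = n by rewrite (perm_size ds) size_tuple.
have /tuple_permP[p sp] := ds.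
have n_gt0 : (0 < n)%N by exact: ltnW.
(* [p] matches the sorted list [s] with the unsorted [d], so [i0] and [i1] index the two smallest
   eigenvalues. *)
pose i0 : 'I_n := p (Ordinal n_gt0); pose i1 : 'I_n := p (Ordinal n_gt1).
have i01 : i0 != i1 by rewrite (inj_eq perm_inj).
have snth k (kn : (k < n)%N) : nth 0 s k = d (p (Ordinal kn)).
  by rewrite sp -[k in LHS]/(val (Ordinal kn)) nth_mktuple tnth_mktuple.
have d01 : d i0 <= d i1.
  rewrite -(snth _ n_gt0) -(snth _ n_gt1).
  by apply: (le_sorted_leq_nth 0 s_sorted); rewrite ?inE ?size_s.
rewrite (snth _ n_gt1) -/i1.
pose sg i := \sum_j P i j.
(* If the coordinates of the first eigenvector sum to zero, it serves alone; otherwise [(al, be)] is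
   chosen orthogonal to the two coordinate sums. *)
have [al [be [albe0 ab_sum]]] : exists al be : R[i],
    (al != 0) || (be != 0) /\ al * sg i0 + be * sg i1 = 0.
  have [->|s0] := eqVneq (sg i0) 0.
    by exists 1, 0; rewrite oner_eq0 mulr0 mul0r addr0.
  exists (- sg i1), (sg i0); rewrite s0 orbT; split=> //; ring.
pose w : 'rV[R[i]]_n := al *: delta_mx 0 i0 + be *: delta_mx 0 i1.
pose v := w *m P.
have vE i : v 0 i = al * P i0 i + be * P i1 i.
  by rewrite /v /w mulmxDl -!scalemxAl -!rowE !mxE.
pose x i := complex.Re (v 0 i); pose y i := complex.Im (v 0 i).
have vsum : \sum_i v 0 i = 0.
  under eq_bigr do rewrite vE.
  by rewrite big_split/= -!mulr_sumr.
have xsum : \sum_i x i = 0.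
  by rewrite -Re_sum vsum.
have ysum : \sum_i y i = 0.
  by rewrite -Im_sum vsum.
have wnz : w != 0.
  apply/eqP => /rowP w0; move: albe0.
  have := w0 i0; have := w0 i1; rewrite !mxE !eqxx/=.
  rewrite (negbTE i01) eq_sym (negbTE i01) !mulr0 !mulr1 addr0 add0r => -> ->.
  by rewrite eqxx.
pose nw j := complex.Re (w 0 j) ^+ 2 + complex.Im (w 0 j) ^+ 2.
have nw_ge0 j : 0 <= nw j by rewrite addr_ge0 ?sqr_ge0.
have v_norm : \sum_i (x i ^+ 2 + y i ^+ 2) = \sum_j nw j.
  rewrite -!Re_norm; congr (complex.Re (fun_of_matrix _ _ _)).
  by rewrite /v trmx_mul map_mxM mulmxA -(mulmxA w) PP mulmx1.
have v_quad : \sum_i \sum_j (x i * A i j * x j + y i * A i j * y j) =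
    \sum_j d j * nw j.
  rewrite -Re_quad -Re_quad_diag AE; congr (complex.Re (fun_of_matrix _ _ _)).
  rewrite /v trmx_mul map_mxM !mulmxA -(mulmxA w) PP mulmx1.
  by rewrite -(mulmxA _ P) PP mulmx1.
have nw_gt0 : 0 < \sum_j nw j.
  rewrite lt_def sumr_ge0// andbT; apply: contra wnz => /eqP nw0.
  apply/eqP/rowP => j; rewrite [RHS]mxE; apply/eqP.
  have /(_ j isT)/eqP := psumr_eq0P (fun j _ => nw_ge0 j) nw0.
  rewrite /nw paddr_eq0 ?sqr_ge0// !sqrf_eq0.
  by case: (w 0 j) => r1 r2 /= /andP[/eqP-> /eqP->].
(* As [w] is supported on [i0] and [i1], the form at [v] is at most [d i1] times the squared norm of
   [v]. *)
rewrite -(ler_pM2r nw_gt0) -{1}v_norm big_split/= mulrDr.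
apply: (le_trans (lerD (Alam _ xsum) (Alam _ ysum))).
rewrite -big_split/=; under eq_bigr do rewrite -big_split/=.
rewrite v_quad mulr_sumr; apply: ler_sum => j _.
have [->|j0] := eqVneq j i0; first by rewrite ler_wpM2r.
have [->//|j1] := eqVneq j i1.
suff -> : nw j = 0 by rewrite !mulr0.
rewrite /nw !mxE (negbTE j0) (negbTE j1) !andbF !mulr0 addr0 /=.
by rewrite expr0n/= addr0.
Qed.

(** * Reduction to a weighted path *)

(** The double sum runs over ordered pairs, so it is twice the Laplacian form; hence the factor
    2. *)
Lemma mu_ge (R : realType) (G : sgraph) (lam : R) :
    (1 < #|G|)%N ->
    (forall x : G -> R, \sum_u x u = 0 ->
      2 * lam * \sum_u x u ^+ 2 <=
      \sum_u \sum_v (adj u v)%:R * (x u - x v) ^+ 2) ->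
  lam <= mu R G.
Proof.
move=> G_gt1 Glam; apply: second_eigenvalue_ge => //.
  apply/matrixP => i j; rewrite !mxE adj_sym eq_sym.
  by case: eqP => // ->.
move=> x xsum; pose y u := x (enum_rank u).
have big_G (F : 'I_#|G| -> R) : \sum_i F i = \sum_u F (enum_rank u).
  rewrite (reindex (@enum_rank G))//.
  by exists enum_val => ? _; rewrite ?enum_rankK ?enum_valK.
have ysum : \sum_u y u = 0 by rewrite -big_G.
have := Glam y ysum.
have -> : \sum_u \sum_v (adj u v)%:R * (y u - y v) ^+ 2 =
    2 * \sum_i \sum_j x i * laplacian R G i j * x j.
  rewrite big_G; under [in RHS]eq_bigr do rewrite big_G.
  transitivity (2 * \sum_(u : G) (degree u)%:R * y u ^+ 2
      - 2 * \sum_u \sum_v (adj u v)%:R * (y u * y v)).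
    have degE u : (degree u)%:R = \sum_v (adj u v)%:R :> R.
      rewrite /degree -sum1dep_card natr_sum big_mkcond/=.
      by apply: eq_bigr => v _; case: (adj u v).
    rewrite mulr2n mulrDl !mul1r.
    have deg2 : \sum_(u : G) (degree u)%:R * y u ^+ 2 =
        \sum_u \sum_v (adj u v)%:R * y v ^+ 2.
      rewrite exchange_big; apply: eq_bigr => u _; rewrite -mulr_suml degE.
      by congr (_ * _); apply: eq_bigr => v _; rewrite adj_sym.
    rewrite {2}deg2 mulrDl !mul1r; rewrite -!big_split -sumrB /=.
    apply: eq_bigr => u _; rewrite degE mulr_suml -!big_split -sumrB /=.
    by apply: eq_bigr => v _; ring.
  rewrite -mulrBr; congr (_ * _); rewrite -sumrB; apply: eq_bigr => u _.
  under [in RHS]eq_bigr => v _.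
    rewrite !mxE !enum_rankK (inj_eq enum_rank_inj) -/(y u) -/(y v).
    rewrite mulrBr mulrBl; over.
  rewrite sumrB; congr (_ - _); last by apply: eq_bigr => v _; ring.
  rewrite (bigD1 u)//= eqxx mulr1n big1 ?addr0; first by ring.
  by move=> v; rewrite eq_sym => /negbTE ->; rewrite mulr0n mulr0 mul0r.
rewrite -mulrA ler_pM2l//; congr (_ * _ <= _).
by rewrite big_G.
Qed.

(** The induction keeps only the diagonal and neighbouring entries of the new row and column; the
    others are dropped by nonnegativity, so their indicators are never evaluated. *)
Lemma tridiagonal_sum_le (R : realDomainType) (P : nat -> nat -> R) (N : nat) :
    (forall k k', 0 <= P k k') -> (forall k k', P k k' = P k' k) ->
  \sum_(k < N) P k k + 2 * \sum_(k < N.-1) P k k.+1 <=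
  \sum_(k < N) \sum_(k' < N) ((k <= k'.+1) && (k' <= k.+1))%N%:R * P k k'.
Proof.
move=> P0 Psym; elim: N => [|N IH]; first by rewrite !big_ord0 mulr0 addr0.
rewrite !big_ord_recr/=.
under [in leRHS]eq_bigr do rewrite big_ord_recr/=.
rewrite big_split/= leqnSn mul1r.
have lastP : 2 * \sum_(k < N) P k k.+1 <= 2 * \sum_(k < N.-1) P k k.+1 +
    (\sum_(k < N) ((k <= N.+1) && (N <= k.+1))%N%:R * P k N +
     \sum_(k < N) ((N <= k.+1) && (k <= N.+1))%N%:R * P N k).
  case: N {IH} => [|N]; first by rewrite !big_ord0 !addr0.
  rewrite !big_ord_recr/= leqnn (leqW (leqnSn N)) !mul1r (Psym N.+1 N).
  rewrite mulrDr lerD2l mulr2n mulrDl !mul1r.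
  by apply: lerD; rewrite lerDr sumr_ge0// => k _; rewrite mulr_ge0.
move: IH lastP; lra.
Qed.

Definition layer_size (V : finType) (pos : V -> nat) (k : nat) :=
  #|[pred u | pos u == k]|.

Lemma sum_layers (R : nmodType) (V : finType) (pos : V -> nat) (N : nat)
    (F : V -> R) : (forall u, pos u < N)%N ->
  \sum_u F u = \sum_(k < N) \sum_(u | pos u == k) F u.
Proof.
by move=> posN; rewrite (partition_big (fun u => Ordinal (posN u)) xpredT).
Qed.

Lemma sum_sqr_centered (R : realFieldType) (V : finType) (A : pred V)
    (x : V -> R) : (0 < #|A|)%N ->
  let y := (\sum_(u in A) x u) / #|A|%:R in
  \sum_(u in A) x u ^+ 2 = #|A|%:R * y ^+ 2 + \sum_(u in A) (x u - y) ^+ 2.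
Proof.
move=> A_gt0 y; have A0 : #|A|%:R != 0 :> R by rewrite pnatr_eq0 -lt0n.
under [in RHS]eq_bigr do rewrite sqrrB -mulrnAr.
rewrite big_split sumrB/= -mulr_suml sumr_const.
have -> : \sum_(u in A) x u = #|A|%:R * y by rewrite mulrC divfK.
by rewrite -mulr_natl; ring.
Qed.

Lemma sum_sqr_diff (R : realFieldType) (V : finType) (A B : pred V)
    (x : V -> R) :
  \sum_(u in A) \sum_(v in B) (x u - x v) ^+ 2 =
  #|B|%:R * \sum_(u in A) x u ^+ 2 + #|A|%:R * \sum_(v in B) x v ^+ 2
  - 2 * (\sum_(u in A) x u) * \sum_(v in B) x v.
Proof.
transitivity (\sum_(u in A) \sum_(v in B) (x u ^+ 2 + x v ^+ 2 - 2 * x u * x v)).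
  by apply: eq_bigr => u _; apply: eq_bigr => v _; ring.
under eq_bigr do rewrite sumrB big_split/= sumr_const -mulr_sumr.
rewrite sumrB big_split/= sumr_const -mulr_suml -mulr_sumr !mulr_natl.
by rewrite sumrMnl.
Qed.

(* The deviations from the layer means contribute at least their own square   *)
(* norm to the energy, so only layerwise constant functions matter.           *)
Lemma mu_layered_ge (R : realType) (G : sgraph) (pos : G -> nat) (N : nat)
    (lam : R) (s := fun k => (layer_size pos k)%:R : R) :
    (1 < #|G|)%N -> lam <= 1 -> (forall u, pos u < N)%N ->
    (forall k, (k < N)%N -> 0 < layer_size pos k)%N ->
    (forall u v, u != v -> pos u <= (pos v).+1 -> pos v <= (pos u).+1 ->
      adj u v)%N ->
    (forall y : nat -> R, \sum_(k < N) s k * y k = 0 ->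
      lam * \sum_(k < N) s k * y k ^+ 2 <=
      \sum_(k < N.-1) s k * s k.+1 * (y k - y k.+1) ^+ 2) ->
  lam <= mu R G.
Proof.
move=> G_gt1 lam1 posN s_gt0 adjG chain; apply: mu_ge => // x xsum.
pose L k := [pred u | pos u == k].
pose y k := (\sum_(u in L k) x u) / s k.
pose Z k := \sum_(u in L k) (x u - y k) ^+ 2.
have Z0 k : 0 <= Z k by apply: sumr_ge0 => u _; exact: sqr_ge0.
have s1 k : (k < N)%N -> 1 <= s k by move=> kN; rewrite ler1n s_gt0.
have sumL k : (k < N)%N -> \sum_(u in L k) x u = s k * y k.
  by move=> kN; rewrite mulrC divfK// pnatr_eq0 -lt0n s_gt0.
have sqrL k : (k < N)%N -> \sum_(u in L k) x u ^+ 2 = s k * y k ^+ 2 + Z k.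
  by move=> kN; rewrite sum_sqr_centered ?s_gt0.
pose P k k' := \sum_(u in L k) \sum_(v in L k') (x u - x v) ^+ 2.
have P0 k k' : 0 <= P k k'.
  by apply: sumr_ge0 => u _; apply: sumr_ge0 => v _; exact: sqr_ge0.
have Psym k k' : P k k' = P k' k.
  rewrite /P exchange_big; apply: eq_bigr => u _; apply: eq_bigr => v _; ring.
(* Deviations from the mean sum to zero on each layer, so means and deviations separate. *)
have PE k k' : (k < N)%N -> (k' < N)%N ->
    P k k' = s k * s k' * (y k - y k') ^+ 2 + s k' * Z k + s k * Z k'.
  by move=> kN k'N; rewrite /P sum_sqr_diff !sqrL// !sumL//; rewrite -!/(s _); ring.
have energy : \sum_u \sum_v ((pos u <= (pos v).+1) && (pos v <= (pos u).+1))%N%:R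
      * (x u - x v) ^+ 2
    <= \sum_u \sum_v (adj u v)%:R * (x u - x v) ^+ 2.
  apply: ler_sum => u _; apply: ler_sum => v _.
  have [->|uv] := eqVneq u v; first by rewrite subrr expr0n !mulr0.
  rewrite ler_wpM2r ?sqr_ge0// ler_nat.
  by case: (boolP (_ && _)) => // /andP[uv1 uv2]; rewrite adjG.
apply: le_trans energy.
rewrite [leRHS](_ : _ = \sum_(k < N) \sum_(k' < N)
    ((k <= k'.+1) && (k' <= k.+1))%N%:R * P k k'); last first.
  rewrite (sum_layers _ posN); apply: eq_bigr => k _.
  under eq_bigr do rewrite (sum_layers _ posN).
  rewrite exchange_big; apply: eq_bigr => k' _ /=.
  rewrite /P mulr_sumr; apply: eq_bigr => u /eqP <-.
  by rewrite mulr_sumr; apply: eq_bigr => v /eqP <-.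
apply: le_trans (tridiagonal_sum_le _ P0 Psym).
have -> : \sum_u x u ^+ 2 = \sum_(k < N) s k * y k ^+ 2 + \sum_(k < N) Z k.
  rewrite (sum_layers _ posN) -big_split; apply: eq_bigr => k _ /=.
  by rewrite -sqrL.
have ysum : \sum_(k < N) s k * y k = 0.
  rewrite -[RHS]xsum (sum_layers _ posN).
  by apply: eq_bigr => k _; rewrite -sumL.
(* [P k k] is [2 * s k * Z k] with [s k] at least 1; as [lam] is at most 1, this pays for the
   deviation part of the norm. *)
have diag : 2 * \sum_(k < N) Z k <= \sum_(k < N) P k k.
  rewrite mulr_sumr; apply: ler_sum => k _; rewrite PE// subrr expr0n mulr0 add0r.
  by have := ler_wpM2r (Z0 k) (s1 k (ltn_ord k)); lra.
have off : \sum_(k < N.-1) s k * s k.+1 * (y k - y k.+1) ^+ 2 <=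
    \sum_(k < N.-1) P k k.+1.
  apply: ler_sum => k _; have kN : (k.+1 < N)%N by rewrite -ltn_predRL.
  by rewrite PE// ?(ltnW kN)// -addrA lerDl addr_ge0// mulr_ge0.
have Zsum : lam * \sum_(k < N) Z k <= \sum_(k < N) Z k.
  by rewrite ler_piMl// sumr_ge0.
by move: (chain y ysum) diag off Zsum; lra.
Qed.

(** * Poincare inequality on a periodically weighted path *)

(** The sine [g] is an eigenfunction positive at the inner vertices. Its Riccati variable lets the
    difference of the two sides be written, edge by edge, as a sum of squares. *)
Lemma dirichlet_path (R : realType) (n : nat) (F : nat -> R) :
    (0 < n)%N -> F 0 = 0 -> F n = 0 ->
  2 * (1 - cos (pi / n%:R)) * \sum_(0 <= j < n) F j ^+ 2 <=
  \sum_(0 <= j < n) (F j.+1 - F j) ^+ 2.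
Proof.
(* For a single edge [g] has no positive value to divide by, but both sides vanish. *)
case: n => // -[_ F0 F1|n _ F0 Fn].
  by rewrite !big_nat1 F0 F1 subrr expr0n mulr0.
set om := pi / _; set K := 2 * _.
pose g (j : nat) : R := sin (j%:R * om).
have om_gt0 : 0 < om by rewrite divr_gt0 ?pi_gt0 ?ltr0n.
have g_gt0 j : (0 < j < n.+2)%N -> 0 < g j.
  case/andP=> j_gt0 jn; apply: sin_gt0_pi; rewrite mulr_gt0 ?ltr0n//=.
  by rewrite /om mulrA ltr_pdivrMr ?ltr0n// mulrC ltr_pM2l ?pi_gt0// ltr_nat.
have g_rec j : g j.+2 + g j = 2 * cos om * g j.+1.
  have -> : g j.+2 = sin (j.+1%:R * om + om) by rewrite /g -natr1 mulrDl mul1r.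
  have -> : g j = sin (j.+1%:R * om - om) by rewrite /g -natr1 mulrDl mul1r addrK.
  by rewrite sinB sinD /g; ring.
have g0 : g 0%N = 0 by rewrite /g mul0r sin0.
have gn : g n.+2 = 0 by rewrite /g /om mulrC divfK ?sinpi// pnatr_eq0.
(* [rho] is the discrete Riccati variable of the positive solution [g].       *)
pose rho j := (g j.+1 - g j) / g j.+1.
have riccati j : (j < n.+1)%N ->
    K * \sum_(0 <= i < j.+1) F i ^+ 2 + rho j * F j.+1 ^+ 2 <=
    \sum_(0 <= i < j.+1) (F i.+1 - F i) ^+ 2.
  elim: j => [_|j IH jn].
    by rewrite !big_nat1 F0 /rho g0 !subr0 divff ?gt_eqF ?g_gt0// expr0n mulr0 mul1r add0r.
  rewrite !(big_nat_recr j.+1)//=.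
  have := IH (ltnW jn); have := g_rec j; rewrite /rho.
  have := g_gt0 j.+1 (ltnW jn); have := g_gt0 j.+2 jn.
  move: (g j) (g j.+1) (g j.+2) (F j.+1) (F j.+2) => a b c u v c_gt0 b_gt0 rc.
  suff : K * u ^+ 2 + (c - b) / c * v ^+ 2 <= (b - a) / b * u ^+ 2 + (v - u) ^+ 2.
    lra.
  (* The recurrence for [g] makes the defect a perfect square. *)
  rewrite -subr_ge0 [leRHS](_ : _ = (u * c - v * b) ^+ 2 / (b * c)).
    by rewrite divr_ge0 ?sqr_ge0// mulr_ge0 ?ltW.
  have -> : K = 2 - (c + a) / b by rewrite rc mulfK ?gt_eqF// /K; ring.
  by field; rewrite !gt_eqF.
rewrite !(big_nat_recr n.+1)//= Fn sub0r sqrrN.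
have := riccati n (leqnn _).
have := g_gt0 n.+1 (leqnn _); have := g_rec n; rewrite gn /rho => rc b_gt0.
(* The last edge contributes [F n.+1 ^+ 2], exactly what is missing because [g] vanishes at the
   endpoint. *)
suff -> : (g n.+1 - g n) / g n.+1 = K - 1 by lra.
have -> : g n = 2 * cos om * g n.+1 by rewrite -rc add0r.
by rewrite /K; field; rewrite gt_eqF.
Qed.

Lemma oscillation_le (R : realDomainType) (f tau : nat -> R) (lo hi p q : nat) :
    (forall j, `|f j.+1 - f j| <= tau j) ->
    (lo <= p <= hi)%N -> (lo <= q <= hi)%N ->
  f p <= f q + \sum_(lo <= i < hi) tau i.
Proof.
move=> ftau; have tau0 j : 0 <= tau j by exact: le_trans (ftau j).
(* For [q < p], pass to [- f] with [p] and [q] exchanged; the increments keep their absolute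
   values. *)
wlog pq : f ftau p q / (p <= q)%N.
  move=> W /andP[lop phi] /andP[loq qhi]; have [pq|/ltnW qp] := leqP p q.
    by apply: W => //; apply/andP.
  have := W (fun j => - f j) _ q p qp; rewrite /= lerNl opprD !opprK => {}W.
  rewrite -lerBlDr; apply: W; rewrite ?lop ?loq//.
  by move=> j; rewrite -normrN opprB opprK addrC.
move=> /andP[lop _] /andP[_ qhi]; rewrite -lerBlDl.
have -> : f p - f q = - \sum_(p <= i < q) (f i.+1 - f i).
  by rewrite telescope_sumr// opprB.
apply: le_trans (_ : \sum_(p <= i < q) tau i <= _).
  rewrite -sumrN; apply: ler_sum => i _.
  by apply: le_trans (ftau i); rewrite -normrN ler_norm.
rewrite (big_cat_nat lop (leq_trans pq qhi))/= (big_cat_nat pq qhi)/=.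
have := sumr_ge0 (index_iota lo p) (fun i (_ : true) => tau0 i).
have := sumr_ge0 (index_iota q hi) (fun i (_ : true) => tau0 i).
lra.
Qed.

(** [oscillation_le] compares [f p] with each of the [D] values in the period; summing gives the
    claim. *)
Lemma period_average_le (R : realDomainType) (f tau : nat -> R) (lo D p : nat) :
    (forall j, `|f j.+1 - f j| <= tau j) -> (lo <= p <= lo + D)%N ->
  D%:R * f p <=
  \sum_(lo <= j < lo + D) f j + D%:R * \sum_(lo <= j < lo + D) tau j.
Proof.
move=> ftau pD.
have -> : D%:R * f p = \sum_(lo <= j < lo + D) f p.
  by rewrite sumr_const_nat addKn mulr_natl.
have -> : D%:R * \sum_(lo <= j < lo + D) tau j =
    \sum_(lo <= j < lo + D) \sum_(lo <= j < lo + D) tau j.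
  by rewrite sumr_const_nat addKn mulr_natl.
rewrite -big_split/=; apply: ler_sum_nat => j /andP[loj jD].
by apply: oscillation_le => //; rewrite loj ltnW.
Qed.

Lemma sum_periods (R : nmodType) (f : nat -> R) (D M : nat) :
  \sum_(0 <= j < M * D) f j =
  \sum_(0 <= q < M) \sum_(q * D <= j < q * D + D) f j.
Proof. by rewrite big_nat_mul; apply: eq_bigr => q _; rewrite mulSnr. Qed.

(* [e q] accounts for a link between two blocks at the end of period [q],     *)
(* whose weight differs from [1 / (ga q * al q)].                             *)
Lemma periodic_mass_le (R : realFieldType) (D M l t : nat)
    (al be ga e : nat -> nat) (f tau : nat -> R) :
    (0 < l)%N ->
    (forall q, q < M -> [/\ 0 < al q, 0 < be q, 0 < ga q,
       al q + be q + ga q = D & l <= al q * be q * ga q])%N ->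
    (\sum_(0 <= q < M) e q <= t)%N ->
    (forall j, 0 <= f j) -> f 0%N = 0 ->
    (forall j, `|f j.+1 - f j| <= tau j) ->
  \sum_(0 <= q < M) (f (q * D + al q)%N / (al q * be q)%:R +
    f (q * D + al q + be q)%N / (be q * ga q)%:R +
    f (q * D + D)%N * (1 / (ga q * al q)%:R + (e q)%:R)) <=
  (\sum_(0 <= j < M * D) f j + D%:R * \sum_(0 <= j < M * D) tau j) / l%:R +
  t%:R * \sum_(0 <= j < M * D) tau j.
Proof.
move=> l_gt0 abc e_le f0 f00 ftau; set T := \sum_(0 <= j < _) tau j.
have tau0 j : 0 <= tau j by exact: le_trans (ftau j).
have T0 : 0 <= T by apply: sumr_ge0.
(* At an exceptional link, [f] is bounded only by its total oscillation from [f 0 = 0]. *)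
have fT q : (q < M)%N -> f (q * D + D)%N <= T.
  move=> qM; rewrite -[leRHS]add0r -[in leRHS]f00.
  by apply: oscillation_le => //=; rewrite -mulSnr leq_mul2r qM orbT.
pose S q := \sum_(q * D <= j < q * D + D) f j.
pose U q := \sum_(q * D <= j < q * D + D) tau j.
apply: le_trans (_ : \sum_(0 <= q < M)
    ((S q + D%:R * U q) / l%:R + (e q)%:R * T) <= _); last first.
  rewrite big_split/= -mulr_suml big_split/= -mulr_sumr -mulr_suml.
  rewrite /S /U -!sum_periods -/T lerD2l ler_wpM2r//.
  by rewrite -natr_sum ler_nat.
apply: ler_sum_nat => q /andP[_ qM].
have [a0 b0 g0 sD lq] := abc q qM.
rewrite mulrDr addrA; apply: lerD; last by rewrite mulrC ler_wpM2l// fT.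
have S0 : 0 <= S q + D%:R * U q.
  by rewrite addr_ge0 ?mulr_ge0// sumr_ge0.
have f1 p : (q * D <= p <= q * D + D)%N -> D%:R * f p <= S q + D%:R * U q.
  by move=> pD; apply: period_average_le.
have D_gt0 : (0 < D%:R :> R) by rewrite ltr0n -sD addn_gt0 g0 orbT.
have {}f1 p : (q * D <= p <= q * D + D)%N -> f p <= (S q + D%:R * U q) / D%:R.
  by move=> pD; rewrite ler_pdivlMr// mulrC f1.
have aR : 0 < (al q)%:R :> R by rewrite ltr0n.
have bR : 0 < (be q)%:R :> R by rewrite ltr0n.
have gR : 0 < (ga q)%:R :> R by rewrite ltr0n.
(* Since [al q + be q + ga q = D], the three reciprocal weights add up to [D] over the product,
   which cancels the [D] of the average. *)
apply: le_trans (_ : (S q + D%:R * U q) / (al q * be q * ga q)%:R <= _).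
  set X := S q + _ in S0 f1 *.
  apply: le_trans (_ : X / D%:R / (al q * be q)%:R + X / D%:R / (be q * ga q)%:R
     + X / D%:R * (1 / (ga q * al q)%:R) <= _).
    rewrite !lerD//; rewrite ler_wpM2r ?invr_ge0 ?divr_ge0 ?ler0n//; apply: f1; lia.
  rewrite le_eqVlt; apply/orP; left; apply/eqP.
  move: D_gt0; rewrite -sD !natrM !natrD => D_gt0; field.
  by rewrite !gt_eqF.
rewrite ler_wpM2l// lef_pV2 ?posrE ?ltr0n ?muln_gt0 ?a0 ?b0 ?g0//.
by rewrite ler_nat.
Qed.

(* [h] takes the value [y k] on each of the [s k] vertices of cell [k].       *)
Lemma unit_refinement (T : Type) (s : nat -> nat) (y : nat -> T) (N : nat) :
  exists h : nat -> T, forall k j, (k < N)%N ->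
    (\sum_(0 <= i < k) s i <= j < \sum_(0 <= i < k.+1) s i)%N -> h j = y k.
Proof.
elim: N => [|N [h hE]]; first by exists (fun=> y 0%N).
exists (fun j => if (j < \sum_(0 <= i < N) s i)%N then h j else y N) => k j.
rewrite ltnS leq_eqVlt => /predU1P[->|kN] /andP[kj jk]; first by rewrite ltnNge kj.
have jN : (j < \sum_(0 <= i < N) s i)%N.
  by apply: leq_trans jk _; rewrite (big_cat_nat (leq0n k.+1) kN)/= leq_addr.
by rewrite jN (hE k)// kj.
Qed.

Lemma sum_unit_refinement (R : pzSemiRingType) (T : Type) (s : nat -> nat)
    (y h : nat -> T) (phi : T -> R) (N K : nat) :
    (forall k j, (k < N)%N ->
      (\sum_(0 <= i < k) s i <= j < \sum_(0 <= i < k.+1) s i)%N -> h j = y k) ->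
    (K <= N)%N ->
  \sum_(0 <= j < \sum_(0 <= i < K) s i) phi (h j) =
  \sum_(0 <= k < K) (s k)%:R * phi (y k).
Proof.
move=> hE; elim: K => [_|K IH KN]; first by rewrite !big_nil.
have le_K : (\sum_(0 <= i < K) s i <= \sum_(0 <= i < K.+1) s i)%N.
  by rewrite big_nat_recr//= leq_addr.
rewrite (big_cat_nat (leq0n _) le_K)/= IH ?(ltnW KN)// [RHS]big_nat_recr//=.
congr (_ + _); rewrite (eq_big_nat _ _ (F2 := fun=> phi (y K))).
  by rewrite sumr_const_nat big_nat_recr//= addKn mulr_natl.
by move=> j jK; rewrite (hE K).
Qed.

Lemma sum_by_parts (R : comPzRingType) (f y : nat -> R) (N : nat) :
    f 0%N = 0 ->
  \sum_(0 <= k < N.+1) (f k.+1 - f k) * y k =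
  \sum_(0 <= k < N) f k.+1 * (y k - y k.+1) + f N.+1 * y N.
Proof.
move=> f0; elim: N => [|N IH]; first by rewrite big_nat1 big_nil f0 subr0 add0r.
by rewrite big_nat_recr//= IH [in RHS]big_nat_recr//=; ring.
Qed.

(** AM-GM for the cross term of [b ^+ 2 = a ^+ 2 + 2 * a * (b - a) + (b - a) ^+ 2]. With [n] the
    length of the path, the sum of [a ^+ 2] is O(n^2) times the energy, so both terms contribute
    O(n), one order below the main term. *)
Lemma sqr_increment_le (R : realFieldType) (a b n : R) : 0 < n ->
  `|b ^+ 2 - a ^+ 2| <= (n + 1) * (b - a) ^+ 2 + a ^+ 2 / n.
Proof.
move=> n_gt0.
have p : 0 <= (n * (b - a) + a) ^+ 2 / n by rewrite divr_ge0 ?sqr_ge0 ?ltW.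
have m : 0 <= (n * (b - a) - a) ^+ 2 / n by rewrite divr_ge0 ?sqr_ge0 ?ltW.
have pE : (n * (b - a) + a) ^+ 2 / n =
    n * (b - a) ^+ 2 + 2 * a * (b - a) + a ^+ 2 / n.
  by field; rewrite gt_eqF.
have mE : (n * (b - a) - a) ^+ 2 / n =
    n * (b - a) ^+ 2 - 2 * a * (b - a) + a ^+ 2 / n.
  by field; rewrite gt_eqF.
have := sqr_ge0 (b - a).
rewrite ler_norml pE mE in p m *; move=> ba.
have -> : b ^+ 2 = a ^+ 2 + 2 * a * (b - a) + (b - a) ^+ 2 by ring.
by apply/andP; split; lra.
Qed.

(** The reciprocal of the lowest Dirichlet eigenvalue of the path with [n] edges. *)
Definition path_const {R : realType} (n : nat) : R :=
  (2 * (1 - cos (pi / n%:R)))^-1.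

(* Bounds, relative to the energy of [F], the sum of the increments of        *)
(* [F ^ 2] as estimated in [sqr_increment_le].                                *)
Definition oscillation_const {R : realType} (n : nat) : R :=
  n%:R + 1 + path_const n / n%:R.

(** The first part, [path_const n / l], grows like n^2 / (l pi^2); the terms with
    [oscillation_const] are O(n), [D] coming from averaging over a period and [t] from the
    exceptional links. *)
Definition chain_const {R : realType} (D l t n : nat) : R :=
  (path_const n + D%:R * oscillation_const n) / l%:R + t%:R * oscillation_const n.

Lemma path_const_gt0 (R : realType) (n : nat) :
  (0 < n)%N -> 0 < path_const n :> R.
Proof.
move=> n_gt0; rewrite /path_const invr_gt0 mulr_gt0// subr_gt0.
have n1 : 1 <= n%:R :> R by rewrite ler1n.
have n0 : 0 < n%:R :> R by rewrite ltr0n.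
rewrite -[ltRHS]cos0 ltr_cos ?in_itv/= ?lexx ?pi_ge0//.
  by rewrite divr_gt0 ?pi_gt0.
by rewrite divr_ge0 ?pi_ge0 ?ler0n//= ler_pdivrMr// ler_peMr// pi_ge0.
Qed.

Lemma sum_three (R : nmodType) (f : nat -> R) (M : nat) :
  \sum_(0 <= k < M * 3) f k =
  \sum_(0 <= q < M) (f (q * 3)%N + f (q * 3).+1 + f (q * 3).+2).
Proof.
rewrite sum_periods; apply: eq_bigr => q _.
rewrite !addnS addn0 (big_ltn (leqW (leqW _)))//.
by rewrite (big_ltn (leqW _))// big_nat1 addrA.
Qed.

Lemma chain_poincare (R : realType) (D l t M : nat)
    (al be ga e s : nat -> nat) (y : nat -> R) :
    (0 < l)%N -> (0 < M)%N ->
    (forall q, q < M -> [/\ 0 < al q, 0 < be q, 0 < ga q,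
       al q + be q + ga q = D & l <= al q * be q * ga q])%N ->
    (forall q, q < M -> [/\ s (q * 3) = al q, s (q * 3).+1 = be q
       & s (q * 3).+2 = ga q])%N ->
    (forall q, q.+1 < M -> e q = 0 -> al q.+1 = al q)%N ->
    (\sum_(0 <= q < M) e q <= t)%N ->
    \sum_(0 <= k < M * 3) (s k)%:R * y k = 0 ->
  \sum_(0 <= k < M * 3) (s k)%:R * y k ^+ 2 <=
  chain_const D l t (M * D) *
  \sum_(0 <= k < (M * 3).-1) (s k)%:R * (s k.+1)%:R * (y k - y k.+1) ^+ 2.
Proof.
move=> l_gt0 M_gt0 abc sE al_eq e_le y0.
pose N := (M * 3)%N; pose n := (M * D)%N.
pose p k := (\sum_(0 <= i < k) s i)%N.
have N_gt0 : (0 < N)%N by rewrite muln_gt0 M_gt0.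
have D_gt0 : (0 < D)%N.
  by have [a0 _ _ <- _] := abc 0%N M_gt0; rewrite !addn_gt0 a0.
have n_gt0 : (0 < n)%N by rewrite muln_gt0 M_gt0.
have p3 q : (q <= M)%N -> p (q * 3)%N = (q * D)%N.
  elim: q => [_|q IH qM]; first by rewrite /p big_nil.
  rewrite !mulSn !addSn add0n /p !(big_nat_recr _ 0)//= -/(p _) IH ?(ltnW qM)//.
  have [-> -> ->] := sE q qM; have [_ _ _ <- _] := abc q qM; lia.
have [h hE] := unit_refinement s y N.
pose F j := \sum_(0 <= i < j) h i.
have FS j : F j.+1 - F j = h j by rewrite /F big_nat_recr//= addrAC subrr add0r.
have Fp k : (k <= N)%N -> F (p k) = \sum_(0 <= i < k) (s i)%:R * y i.
  exact: (sum_unit_refinement idfun hE).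
have F0 : F 0%N = 0 by rewrite /F big_nil.
have Fn : F n = 0 by rewrite /n -p3// Fp.
set H := \sum_(0 <= k < _) _.
have HE : H = \sum_(0 <= j < n) h j ^+ 2.
  by rewrite /n -p3// (sum_unit_refinement (fun z => z ^+ 2) hE).
have H_ge0 : 0 <= H by rewrite HE sumr_ge0// => j _; exact: sqr_ge0.
have A_gt0 := path_const_gt0 R n_gt0; set A := path_const n in A_gt0.
have sumF : \sum_(0 <= j < n) F j ^+ 2 <= A * H.
  rewrite -ler_pdivrMl// /A /path_const invrK HE.
  have := dirichlet_path n_gt0 F0 Fn.
  by under [in leRHS]eq_bigr do rewrite FS.
have nR : 0 < n%:R :> R by rewrite ltr0n.
pose tau j := (n%:R + 1) * h j ^+ 2 + F j ^+ 2 / n%:R.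
have sum_tau : \sum_(0 <= j < n) tau j <= oscillation_const n * H.
  rewrite big_split/= -mulr_sumr -mulr_suml -HE /oscillation_const -/A.
  by rewrite [leRHS]mulrDl lerD2l mulrAC ler_wpM2r// invr_ge0 ltW.
have Ftau j : `|F j.+1 ^+ 2 - F j ^+ 2| <= tau j.
  by rewrite /tau -FS; exact: sqr_increment_le.
set B := chain_const _ _ _ _; set E := \sum_(0 <= k < _.-1) _.
pose w k : R := ((s k)%:R * (s k.+1)%:R)^-1.
have mass : \sum_(0 <= k < N) F (p k.+1) ^+ 2 * w k <= B * H.
  rewrite sum_three; apply: le_trans (_ : _ <= (\sum_(0 <= j < n) F j ^+ 2 +
      D%:R * \sum_(0 <= j < n) tau j) / l%:R +
      t%:R * \sum_(0 <= j < n) tau j) _; last first.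
    rewrite /B /chain_const [leRHS]mulrDl; apply: lerD; last first.
      by rewrite -mulrA ler_wpM2l.
    rewrite [leRHS]mulrAC ler_wpM2r ?invr_ge0 ?ler0n//.
    by rewrite [leRHS]mulrDl lerD// -mulrA ler_wpM2l.
  have := periodic_mass_le l_gt0 abc e_le (fun j => sqr_ge0 (F j)) _ Ftau.
  rewrite F0 expr0n => /(_ erefl); apply: le_trans; apply: ler_sum_nat => q qM.
  have [a0 b0 g0 sD lq] := abc q qM; have [s0 s1 s2] := sE q qM.
  have pS k : p k.+1 = (p k + s k)%N by rewrite /p big_nat_recr.
  rewrite !pS p3 ?(ltnW qM)// s0 s1 s2.
  have -> : (q * D + al q + be q + ga q = q * D + D)%N by rewrite -sD !addnA.
  rewrite /w s0 s1 s2 !natrM lerD2l.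
  (* The last cell has no successor, so its weight involves [s] beyond the chain; the factor
     [F n = 0] removes it. *)
  have [qM1|Mq] := ltnP q.+1 M; last first.
    have -> : (q * D + D)%N = n by rewrite -mulSnr /n; congr (_ * _)%N; lia.
    by rewrite Fn expr0n !mul0r.
  rewrite ler_wpM2l ?sqr_ge0// div1r.
  (* Either the next period starts with the same cell size and the weight is exact, or the weight is
     at most 1, hence at most [e q]. *)
  have [eq0|eq_gt0] := posnP (e q).
    rewrite -[(q * 3).+3]/(q.+1 * 3)%N.
    by have [-> _ _] := sE _ qM1; rewrite (al_eq _ qM1 eq0) eq0 addr0.
  apply: le_trans (_ : 1 <= _).
    have [-> _ _] := sE _ qM1.
    rewrite -natrM invf_le1 ?ler1n ?ltr0n muln_gt0 g0/=.
      by case: (abc _ qM1).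
    by case: (abc _ qM1).
  by rewrite -[leLHS]add0r lerD ?ler1n// invr_ge0 mulr_ge0.
have [N' NE] : exists N', N = N'.+1 by exists N.-1; rewrite prednK.
have HS : H = \sum_(0 <= k < N'.+1) (F (p k.+1) - F (p k)) * y k.
  rewrite /H -/N NE; apply: eq_big_nat => k; rewrite -NE => /andP[_ kN].
  by rewrite !Fp// ?(ltnW kN)// big_nat_recr//=; ring.
have p0 : F (p 0%N) = 0 by rewrite /p big_nil.
rewrite (@sum_by_parts _ (fun k => F (p k)) y N')// in HS.
have FN : F (p N'.+1) = 0 by rewrite -NE Fp.
rewrite FN mul0r addr0 in HS.
have osc_gt0 : 0 < oscillation_const n :> R.
  by rewrite addr_gt0 ?divr_gt0// addr_gt0.
have B_gt0 : 0 < B.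
  rewrite /B /chain_const -/n -/A.
  rewrite ltr_wpDr ?(mulr_ge0 _ (ltW osc_gt0))//.
  by rewrite divr_gt0 ?ltr0n// addr_gt0// mulr_gt0 ?ltr0n.
have s_gt0 k : (k < N)%N -> (0 < s k)%N.
  rewrite (divn_eq k 3) => kN; have qM : (k %/ 3 < M)%N by lia.
  have [a0 b0 g0 _ _] := abc _ qM; have [s0 s1 s2] := sE _ qM.
  have : (k %% 3 < 3)%N by rewrite ltn_mod.
  by case: (k %% 3)%N => [|[|[|//]]] _; rewrite ?addn0 ?addn1 ?addn2 ?s0 ?s1 ?s2.
(* AM-GM: [u * v <= u ^ 2 / (2 B s s') + B s s' v ^ 2 / 2].                   *)
have HB : H <= (2 * B)^-1 * (B * H) + B / 2 * E.
  apply: le_trans (lerD (ler_wpM2l _ mass) (lexx _)); last first.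
    by rewrite invr_ge0 mulr_ge0// ltW.
  rewrite HS /E -/N NE/= big_nat_recr//= FN expr0n mul0r addr0.
  rewrite !mulr_sumr -big_split; apply: ler_sum_nat => k /= kN'.
  rewrite /w.
  have sk : 0 < (s k)%:R :> R by rewrite ltr0n s_gt0// NE ltnW.
  have sk1 : 0 < (s k.+1)%:R :> R by rewrite ltr0n s_gt0// NE.
  move: (y k - y k.+1) (F _) => v u.
  rewrite -subr_ge0 [leRHS](_ : _ =
    (u - B * (s k)%:R * (s k.+1)%:R * v) ^+ 2 / (2 * B * (s k)%:R * (s k.+1)%:R)).
    by rewrite divr_ge0 ?sqr_ge0// !mulr_ge0// ltW.
  by field; rewrite !gt_eqF.
(* Half of [H] is absorbed into the left-hand side, leaving [H <= B * E]. *)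
have BB : (2 * B)^-1 * (B * H) = H / 2 by field; rewrite gt_eqF.
by rewrite BB in HB; lra.
Qed.

(** * Asymptotics of the constant *)

(** Makes the reciprocal at most 1, as [mu_layered_ge] demands of [lam]. *)
Lemma chain_const_ge1 (R : realType) (D l t n : nat) :
  (0 < n)%N -> (0 < t)%N -> 1 <= chain_const D l t n :> R.
Proof.
move=> n_gt0 t_gt0; have A_gt0 := path_const_gt0 R n_gt0.
have osc1 : 1 <= oscillation_const n :> R.
  by rewrite /oscillation_const addrAC lerDr addr_ge0// divr_ge0// ltW.
have osc0 := le_trans ler01 osc1.
rewrite /chain_const -[leLHS]add0r lerD//.
  by rewrite divr_ge0// addr_ge0 ?mulr_ge0// ltW.
by rewrite mulr_ege1// ler1n.
Qed.

Lemma cvg_sin_div (R : realType) : h^-1 * sin h @[h --> 0^'] --> (1 : R).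
Proof.
have sin_der := is_derive_sin (0 : R).
have : h^-1 *: ((sin \o shift 0) (h *: 1) - sin 0) @[h --> 0^'] -->
    'D_1 sin (0 : R).
  exact: (@ex_derive _ _ _ _ _ _ _ sin_der).
rewrite (derive_val (is_derive := sin_der)) cos0.
apply: cvg_trans; apply: near_eq_cvg; near=> h.
by rewrite /= addr0 sin0 subr0 scaler1.
Unshelve. all: by end_near. Qed.

Lemma cvg_invn (R : realType) : n%:R^-1 @[n --> \oo] --> (0 : R).
Proof. by rewrite -cvg_shiftS; exact: cvg_harmonic. Qed.

(** With x = pi / (2 n), the half-angle formula turns the quotient into the reciprocal of pi^2 (sin
    x / x)^2. The index is shifted so that x is defined by a nonzero denominator. *)
Lemma cvg_path_const (R : realType) :
  path_const n / n%:R ^+ 2 @[n --> \oo] --> ((pi ^+ 2)^-1 : R).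
Proof.
have pi_neq0 : pi != 0 :> R by rewrite gt_eqF ?pi_gt0.
rewrite -cvg_shiftS; pose x n : R := pi / 2 * n.+1%:R^-1.
have x_neq0 n : x n != 0 by rewrite !mulf_neq0 ?invr_neq0 ?pnatr_eq0.
have x_cvg : x n @[n --> \oo] --> (0 : R).
  by rewrite -[0 in X in _ --> X](mulr0 (pi / 2)); apply: cvgMr; exact: cvg_harmonic.
have /cvgr_dnbhsP/(_ x (conj x_neq0 x_cvg)) sinc := @cvg_sin_div R.
have : (pi ^+ 2 * ((x n)^-1 * sin (x n) * ((x n)^-1 * sin (x n))))^-1
    @[n --> \oo] --> (pi ^+ 2)^-1.
  have pi2 : pi ^+ 2 * (1 * 1) != 0 :> R by rewrite !mulr1 expf_neq0.
  have -> : (pi ^+ 2)^-1 = (pi ^+ 2 * (1 * 1))^-1 :> R by rewrite !mulr1.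
  exact: cvgV pi2 (cvgMr (cvgM sinc sinc)).
apply: cvg_trans; apply: near_eq_cvg; near=> n.
rewrite /= /path_const [pi / n.+1%:R](_ : _ = x n *+ 2); last first.
  by rewrite -mulr_natr /x; field; rewrite nat1r pnatr_eq0.
rewrite cos_mulr2n cos2sin2 /= -invfM; congr (_^-1).
move: (sin _) => S; rewrite /x; clear - pi_neq0.
move: pi pi_neq0 => c c_neq0; field.
by rewrite nat1r pnatr_eq0 c_neq0.
Unshelve. all: by end_near. Qed.

Lemma cvg_chain_const (R : realType) (D l t : nat) : (0 < l)%N ->
  n%:R ^+ 2 / (l%:R * pi ^+ 2 * chain_const D l t n) - 1 @[n --> \oo]
    --> (0 : R).
Proof.
move=> l_gt0; have l_neq0 : l%:R != 0 :> R by rewrite pnatr_eq0 -lt0n.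
have pi_neq0 : pi != 0 :> R by rewrite gt_eqF ?pi_gt0.
pose u n : R := path_const n / n%:R ^+ 2.
(* For [n > 0] this is [oscillation_const n / n%:R ^+ 2]; [B n] below is
   [l%:R * pi ^+ 2 * chain_const D l t n] divided by the same square. *)
pose o n : R := n%:R^-1 + n%:R^-1 * n%:R^-1 + u n * n%:R^-1.
have ho : o n @[n --> \oo] --> (0 : R).
  have -> : (0 : R) = 0 + 0 * 0 + (pi ^+ 2)^-1 * 0 by rewrite !mulr0 !addr0.
  apply: cvgD; last by apply: cvgM; [exact: cvg_path_const|exact: cvg_invn].
  by apply: cvgD; [|apply: cvgM]; exact: cvg_invn.
pose B n : R := l%:R * pi ^+ 2 * ((u n + D%:R * o n) / l%:R + t%:R * o n).
have hB : B n @[n --> \oo] --> (1 : R).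
  have -> : (1 : R) =
      l%:R * pi ^+ 2 * (((pi ^+ 2)^-1 + D%:R * 0) / l%:R + t%:R * 0).
    rewrite !mulr0 !addr0 -invfM [X in _ / X]mulrC divff//.
    by rewrite mulf_neq0 ?expf_neq0.
  apply: cvgMr; apply: cvgD; last exact: cvgMr.
  apply: cvgMl; apply: cvgD; last exact: cvgMr.
  exact: cvg_path_const.
have : (B n)^-1 - 1 @[n --> \oo] --> (0 : R).
  have -> : (0 : R) = 1^-1 - 1 by rewrite invr1 subrr.
  by apply: cvgB; [exact: cvgV|exact: cvg_cst].
apply: cvg_trans; apply: near_eq_cvg; near=> n.
have n_gt0 : (0 < n)%N by near: n; exists 1%N.
have n_neq0 : n%:R != 0 :> R by rewrite pnatr_eq0 -lt0n.
congr (_ - 1); rewrite [RHS]mulrC -[n%:R ^+ 2]invrK -invfM; congr (_^-1).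
rewrite /B /chain_const /o /u /oscillation_const.
move: (path_const n) (pi ^+ 2) => A c; field.
by rewrite n_neq0 l_neq0.
Unshelve. all: by end_near. Qed.

(** * The cells of Gamma *)

Lemma linked_adj_same (k : nat) (G : 'I_k -> sgraph)
    (link : rel {i : 'I_k & G i}) (i : 'I_k) (x y : G i) :
  linked_adj link (Tagged G x) (Tagged G y) = adj x y.
Proof. by rewrite /linked_adj eqxx tagged_asE. Qed.

(** Counted in periods of three cells, not in cells. *)
Definition block_start (t : nat) (m : 'I_t -> nat) (i : 'I_t) : nat :=
  \sum_(j < t | (j < i)%N) m j.

Lemma block_start_lt (t : nat) (m : 'I_t -> nat) (i j : 'I_t) :
  (i < j)%N -> (block_start m i + m i <= block_start m j)%N.
Proof.
move=> ij; rewrite [leqRHS](bigD1 i)//= addnC leq_add2l.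
rewrite [leqLHS]big_mkcond [leqRHS]big_mkcond; apply: leq_sum => k _ /=.
case: ifP => // ki; rewrite ifT//.
by rewrite (ltn_trans ki ij) neq_ltn ki.
Qed.

(** [tagnat.Rank] numbers the pairs (block, cell) lexicographically, so that bijectivity comes with
    it. *)
Definition cell_rank (t : nat) (a b c m : 'I_t -> nat) (u : Gamma a b c m) :
    nat :=
  tagnat.Rank (p_ := fun i => (3 * m i)%N) (tag u) (cell (tagged u)).

Lemma cell_rankE (t : nat) (a b c m : 'I_t -> nat) (u : Gamma a b c m) :
  cell_rank u = (3 * block_start m (tag u) + cell (tagged u))%N.
Proof. by rewrite /cell_rank tagnat.RankEsum big_distrr. Qed.

Lemma cell_rank_lt (t : nat) (a b c m : 'I_t -> nat) (u : Gamma a b c m) :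
  (cell_rank u < (\sum_i m i) * 3)%N.
Proof. by rewrite mulnC big_distrr; exact: ltn_ord. Qed.

Lemma near_cells_adj (t : nat) (a b c m : 'I_t -> nat) (u v : Gamma a b c m) :
    (forall i, 0 < m i)%N -> u != v ->
  (cell_rank u <= (cell_rank v).+1)%N -> (cell_rank v <= (cell_rank u).+1)%N ->
  adj u v.
Proof.
move=> m_gt0; wlog uv : u v / (tag u <= tag v)%N.
  move=> W; have [uv|/ltnW vu] := leqP (tag u) (tag v); first exact: W.
  by rewrite eq_sym adj_sym => ? ? ?; exact: W.
case: u v uv => i [k j] [i' [k' j']] ii' uv.
rewrite !cell_rankE /cell => le1 le2; rewrite /= in ii' le1 le2.
have [ei|ni] := eqVneq i i'.
  subst i'; apply: (etrans (@linked_adj_same _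
    (fun i => clique_chain (a i) (b i) (c i) (m i)) _ i _ _)).
  have [ek|/eqP nk] := eqVneq k k'.
    subst k'; apply: (etrans (@linked_adj_same _
      (fun k : 'I_(3 * m i) => clique (cell_size (a i) (b i) (c i) k)) _ k _ _)).
    by apply: contra uv => /eqP ->.
  have {}nk : k != k' :> nat by apply/eqP => /val_inj.
  rewrite /= /linked_adj /= ifN//.
  by move/eqP: nk; lia.
have {ii'} ltii : (i < i')%N by rewrite ltn_neqAle ii' andbT.
have s1 := block_start_lt m ltii; have k_lt := ltn_ord k.
rewrite /= /linked_adj /= ifN//.
suff -> : i' = i.+1 :> nat by apply/orP; left; rewrite eqxx /=; lia.
apply/eqP; rewrite eqn_leq ltii andbT leqNgt; apply/negP => lt2.
have it : (i.+1 < t)%N by exact: ltn_trans lt2 _.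
(* A block strictly in between would be nonempty and push the two ranks more than one apart. *)
have := @block_start_lt _ m i (Ordinal it) (leqnn _).
have := @block_start_lt _ m (Ordinal it) i' lt2.
have := m_gt0 (Ordinal it).
lia.
Qed.

Lemma layer_size_cell (t : nat) (a b c m : 'I_t -> nat) (i : 'I_t)
    (k : 'I_(3 * m i)) :
  layer_size (@cell_rank t a b c m) (3 * block_start m i + k) =
  cell_size (a i) (b i) (c i) k.
Proof.
pose f (j : 'I_(cell_size (a i) (b i) (c i) k)) : Gamma a b c m :=
  existT _ i (existT _ k j).
rewrite -[RHS]card_ord -(card_codom (f := f)).
  apply: eq_card => u; rewrite !inE.
  have -> : (3 * block_start m i + k)%N =
      tagnat.Rank (p_ := fun i => (3 * m i)%N) i k.
    by rewrite tagnat.RankEsum big_distrr.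
  rewrite /cell_rank tagnat.eq_Rank; apply/andP/codomP => [[]|[j ->]]//.
  case: u => i' [k' j'] /= /eqP ei; subst i' => /eqP/val_inj ek.
  by move: ek j'; rewrite /cell/= => -> j'; exists j'.
(* A projection to [nat] that recovers the index gives injectivity of [f] without equalities between
   dependent pairs. *)
pose cell_index (u : Gamma a b c m) : nat := nat_of_ord
  (tagged (tagged u) : 'I_(cell_size (a (tag u)) (b (tag u)) (c (tag u))
    (tag (tagged u)))).
by move=> j j' /(congr1 cell_index)/val_inj.
Qed.

Lemma block_decomp (t : nat) (m : 'I_t -> nat) (q : nat) :
    (q < \sum_i m i)%N ->
  exists (i : 'I_t) (r : nat), (r < m i)%N /\ q = (block_start m i + r)%N.
Proof.
move=> qM; exists (tagnat.sig1 (Ordinal qM)), (tagnat.sig2 (Ordinal qM)).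
by split; [exact: ltn_ord|rewrite -tagnat.rect].
Qed.

(** Turns the block parameters into functions of the period number, the form [chain_poincare] takes;
    [option] covers numbers past the last period. *)
Lemma block_of_exists (t : nat) (m : 'I_t -> nat) :
  exists beta : nat -> option 'I_t,
  forall i r, (r < m i)%N -> beta (block_start m i + r)%N = Some i.
Proof.
exists (fun q => omap (fun o : 'I_(\sum_i m i) => tagnat.sig1 o) (insub q)).
move=> i r ri.
have -> : (block_start m i + r)%N = tagnat.Rank (p_ := m) i (Ordinal ri).
  by rewrite tagnat.RankEsum.
by rewrite valK /= tagnat.Rank1K.
Qed.

Lemma sum_nat_eqb (M x : nat) : (\sum_(0 <= q < M) (q == x) = (x < M))%N.
Proof.
elim: M => [|M IH]; first by rewrite big_nil ltn0.
by rewrite big_nat_recr//= IH; lia.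
Qed.

(** Each block start is the successor of at most one [q], and a start at 0 of none. *)
Lemma sum_block_starts (t : nat) (m : 'I_t -> nat) (M : nat) :
  (\sum_(0 <= q < M) \sum_(i < t) (q.+1 == block_start m i) <= t)%N.
Proof.
rewrite exchange_big /= -[leqRHS]card_ord -sum1_card; apply: leq_sum => i _.
case: (block_start m i) => [|x]; first by rewrite big1.
by under eq_bigr do rewrite eqSS; rewrite sum_nat_eqb leq_b1.
Qed.

Lemma cell_size_mod (a b c k : nat) :
  [/\ cell_size a b c (3 * k) = a, cell_size a b c (3 * k).+1 = b
    & cell_size a b c (3 * k).+2 = c].
Proof.
rewrite /cell_size mulnC -[(k * 3).+2]addn2 -[(k * 3).+1]addn1.
by rewrite modnMl !modnMDl.
Qed.

(** * The Poincare inequality applied to Gamma *)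

Lemma mu_Gamma_ge (R : realType) (D t l : nat) (a b c m : 'I_t -> nat) :
    (0 < l)%N -> (0 < t)%N ->
    (forall i, [/\ 0 < a i, 0 < b i, 0 < c i, a i + b i + c i = D
      & l <= a i * b i * c i])%N ->
    (forall i, 0 < m i)%N ->
  (0 < #|Gamma a b c m|)%N /\
  (chain_const D l t #|Gamma a b c m|)^-1 <= mu R (Gamma a b c m).
Proof.
move=> l_gt0 t_gt0 abc m_gt0; set G := Gamma a b c m.
pose M := (\sum_i m i)%N; pose i0 := Ordinal t_gt0.
have M_gt0 : (0 < M)%N by rewrite /M (bigD1 i0)//= addn_gt0 m_gt0.
pose pos := @cell_rank t a b c m; pose s := layer_size pos.
have [beta betaE] := block_of_exists m.
pose blk q := odflt i0 (beta q).
have blkE i r : (r < m i)%N -> blk (block_start m i + r)%N = i.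
  by move=> ri; rewrite /blk betaE.
have abcM q : (q < M)%N -> [/\ 0 < a (blk q), 0 < b (blk q), 0 < c (blk q),
    a (blk q) + b (blk q) + c (blk q) = D
    & l <= a (blk q) * b (blk q) * c (blk q)]%N by move=> _; exact: abc.
have sE q : (q < M)%N -> [/\ s (q * 3) = a (blk q), s (q * 3).+1 = b (blk q)
    & s (q * 3).+2 = c (blk q)]%N.
  move=> /block_decomp[i [r [ri ->]]]; rewrite blkE//.
  have [cs0 cs1 cs2] := cell_size_mod (a i) (b i) (c i) r.
  rewrite mulnC mulnDr -!(addnS _ (3 * r)) -(addnS _ (3 * r).+1).
  have k0 : (3 * r < 3 * m i)%N by lia.
  have k1 : ((3 * r).+1 < 3 * m i)%N by lia.
  have k2 : ((3 * r).+2 < 3 * m i)%N by lia.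
  split; [rewrite -[RHS]cs0|rewrite -[RHS]cs1|rewrite -[RHS]cs2].
  - exact: (layer_size_cell a b c (Ordinal k0)).
  - exact: (layer_size_cell a b c (Ordinal k1)).
  - exact: (layer_size_cell a b c (Ordinal k2)).
(* Positive exactly when period [q.+1] opens a block; elsewhere the parameters do not change. *)
pose e q := (\sum_(i < t) (q.+1 == block_start m i))%N.
have e_eq q : (q.+1 < M)%N -> e q = 0%N -> a (blk q.+1) = a (blk q).
  move=> /block_decomp[i [[|r] [ri qE]]] eq0.
    by move: eq0; rewrite /e (bigD1 i)//= qE addn0 eqxx.
  rewrite qE blkE//; move: qE; rewrite addnS => -[->].
  by rewrite blkE// ltnW.
have posM u : (pos u < M * 3)%N by exact: cell_rank_lt.
have cardG : #|G| = (M * D)%N.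
  rewrite -sum1_card (sum_layers (fun=> 1%N) posM).
  rewrite -(big_mkord xpredT (fun k => \sum_(u | pos u == k) 1)%N).
  under eq_bigr do rewrite sum1_card.
  rewrite [LHS]sum_three.
  rewrite (eq_big_nat _ _ (F2 := fun=> D)).
    by rewrite sum_nat_const_nat subn0.
  move=> q /andP[_ qM]; have [s0 s1 s2] := sE q qM.
  by have [_ _ _ <- _] := abcM q qM; rewrite -s0 -s1 -s2.
have D_gt1 : (1 < D)%N by have [? ? ? <- _] := abc i0; lia.
have G_gt1 : (1 < #|G|)%N by rewrite cardG; nia.
have s_gt0 k : (k < M * 3)%N -> (0 < s k)%N.
  rewrite (divn_eq k 3) => kN; have qM : (k %/ 3 < M)%N by lia.
  have [a0 b0 g0 _ _] := abcM _ qM; have [s0 s1 s2] := sE _ qM.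
  have : (k %% 3 < 3)%N by rewrite ltn_mod.
  by case: (k %% 3)%N => [|[|[|//]]] _; rewrite ?addn0 ?addn1 ?addn2 ?s0 ?s1 ?s2.
have cc1 : 1 <= chain_const D l t #|G| :> R by rewrite chain_const_ge1// ltnW.
split; first exact: ltnW.
apply: (@mu_layered_ge _ _ pos (M * 3)) => //.
- by rewrite invf_le1// (lt_le_trans ltr01).
- by move=> u v; exact: near_cells_adj m_gt0.
move=> y y0; rewrite ler_pdivrMl ?(lt_le_trans ltr01)// cardG.
rewrite -(big_mkord xpredT (fun k => (s k)%:R * y k)) in y0.
have := chain_poincare l_gt0 M_gt0 abcM sE e_eq (sum_block_starts m M) y0.
by rewrite !big_mkord.
Qed.

Theorem theorem6 (R : realType) (d t : nat) (a b c : 'I_t -> nat) (l : nat)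
  (hd : (2 <= d)%N) (ht : (1 <= t)%N)
  (ha : forall i, (0 < a i)%N) (hb : forall i, (0 < b i)%N)
  (hc : forall i, (0 < c i)%N)
  (habc : forall i, (a i + b i + c i = d.+1)%N)
  (hl : exists j, l = (a j * b j * c j)%N)
  (hlmin : forall j, (l <= a j * b j * c j)%N) :
  exists o : nat -> R,
    o n @[n --> \oo] --> (0 : R) /\
    forall m : 'I_t -> nat, (forall i, (0 < m i)%N) ->
      let n := #|Gamma a b c m| in
      (1 + o n) * (l%:R * pi ^+ 2 / n%:R ^+ 2) <= mu R (Gamma a b c m).
Proof.
have l_gt0 : (0 < l)%N by have [j ->] := hl; rewrite !muln_gt0 ha hb hc.
(* Chosen so that the claimed lower bound equals [(chain_const d.+1 l t n)^-1]; it depends on [n],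
   not on how the [m i] share it. *)
exists (fun n => n%:R ^+ 2 / (l%:R * pi ^+ 2 * chain_const d.+1 l t n) - 1).
split=> [|m m_gt0]; first exact: cvg_chain_const.
have abc i : [/\ 0 < a i, 0 < b i, 0 < c i, a i + b i + c i = d.+1
    & l <= a i * b i * c i]%N by split.
have [n_gt0] := mu_Gamma_ge R l_gt0 ht abc m_gt0.
move: #|_| n_gt0 => n n_gt0; apply: le_trans.
have n_neq0 : n%:R != 0 :> R by rewrite pnatr_eq0 -lt0n.
have l_neq0 : l%:R != 0 :> R by rewrite pnatr_eq0 -lt0n.
have pi2_neq0 : pi ^+ 2 != 0 :> R by rewrite expf_neq0// gt_eqF ?pi_gt0.
have c_neq0 : chain_const d.+1 l t n != 0 :> R.
  by rewrite gt_eqF// (lt_le_trans ltr01)// chain_const_ge1.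
move: (pi ^+ 2) (chain_const _ _ _ _) pi2_neq0 c_neq0 => p2 C p2_neq0 C_neq0.
rewrite le_eqVlt; apply/orP; left; apply/eqP; field.
by rewrite n_neq0 l_neq0 p2_neq0 C_neq0.
Qed.
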